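(* The semigroup $T$ given by the semigroup presentation $$T = \langle a,b,c,d,e,x \mid axb = acx,\ ac = cd,\ xcd = xe,\ ed = ae,\ aex = ax,\ xexb = bxex \rangle$$ is LWF (locally wrapped by the class of finite semigroups).
   Context: Maps are written on the right. A semigroup $S$ is called LWF if for every finite subset $H$ of $S$ there exist a finite semigroup $D_H$ and a function $d_H: D_H\to S$ such that $H\subseteq D_Hd_H$ and for all $x',y'\in D_H$ with $x'd_H, y'd_H\in H$ we have $(x'y')d_H = (x'd_H)(y'd_H)$. The presentation is a semigroup presentation: $T$ is the quotient of the free semigroup (nonempty words) on the generators by the congruence generated by the relations; the generator $e$ is not assumed to be idempotent or an identity. *)

(* Defs.v *)
From HB Require Import structures.
From mathcomp Require Import all_boot.
From mathcomp Require Import boolp classical_sets cardinality.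

Set Implicit Arguments.
Unset Strict Implicit.
Unset Printing Implicit Defensive.

Local Open Scope group_scope.
Local Open Scope classical_set_scope.
Local Open Scope quotient_scope.

#[short(type="finSemigroupType")]
HB.structure Definition FinSemigroup := {G of Semigroup G & Finite G}.

Definition LWF (S : semigroupType) : Prop :=
  forall H : set S, finite_set H ->
    exists (D : finSemigroupType) (d : D -> S),
      H `<=` range d /\
      forall x y : D, H (d x) -> H (d y) -> d (x * y) = d x * d y.

(* The empty word is excluded: this is the free semigroup, not the free
   monoid. *)
Record free_semigroup (A : Type) := FreeSemigroup {
  word : seq A;
  _ : ~~ nilp word }.

HB.instance Definition _ (A : Type) := [isSub for @word A].
HB.instance Definition _ (A : choiceType) :=
  [Choice of free_semigroup A by <:].

Section FreeSemigroup.
Variable A : choiceType.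
Implicit Types u v w : free_semigroup A.

Fact catw_subproof u v : ~~ nilp (word u ++ word v).
Proof. by case: u v => [[|a u] //= _] [v _]. Qed.

Definition catw u v := FreeSemigroup (catw_subproof u v).

Fact catwA : associative catw.
Proof. by move=> u v w; apply: val_inj; rewrite /= catA. Qed.

HB.instance Definition _ := isSemigroup.Build (free_semigroup A) catwA.

Definition letter (a : A) := @FreeSemigroup A [:: a] isT.

Lemma word_mul u v : word (u * v) = word u ++ word v.
Proof. by []. Qed.

End FreeSemigroup.

Section Congruence.
Variables (S : semigroupType) (R : S -> S -> Prop).

Inductive congruence_closure : S -> S -> Prop :=
| cc_rel s t : R s t -> congruence_closure s t
| cc_refl s : congruence_closure s s
| cc_sym s t : congruence_closure s t -> congruence_closure t s
| cc_trans s t r :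
    congruence_closure s t -> congruence_closure t r -> congruence_closure s r
| cc_mull r s t :
    congruence_closure s t -> congruence_closure (r * s) (r * t)
| cc_mulr r s t :
    congruence_closure s t -> congruence_closure (s * r) (t * r).

Definition congrb : rel S := fun s t => `[< congruence_closure s t >].

Fact congrb_refl : reflexive congrb.
Proof. by move=> s; apply/asboolP/cc_refl. Qed.

Fact congrb_sym : symmetric congrb.
Proof. by move=> s t; apply: asbool_equiv_eq; split=> /cc_sym. Qed.

Fact congrb_trans : transitive congrb.
Proof.
by move=> t s r /asboolP st /asboolP tr; apply/asboolP/(cc_trans st tr).
Qed.

Canonical congrb_equiv := EquivRel congrb congrb_refl congrb_sym congrb_trans.

Definition quotient_semigroup := {eq_quot congrb}.

HB.instance Definition _ := Choice.on quotient_semigroup.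
HB.instance Definition _ := EqQuotient.on quotient_semigroup.

Definition quotient_class (s : S) : quotient_semigroup :=
  \pi_quotient_semigroup s.

Lemma quotient_classP s t :
  quotient_class s = quotient_class t <-> congruence_closure s t.
Proof. by split=> [/eqmodP/asboolP // | ?]; apply/eqmodP/asboolP. Qed.

Lemma quotient_class_surj (p : quotient_semigroup) :
  exists s, quotient_class s = p.
Proof. by exists (repr p); apply: reprK. Qed.

(* Locked so that unification does not mistake a product for a class. *)
Definition quotient_mul (p q : quotient_semigroup) : quotient_semigroup :=
  locked (quotient_class (repr p * repr q)).

Lemma quotient_mul_class s t :
  quotient_mul (quotient_class s) (quotient_class t) = quotient_class (s * t).
Proof.
rewrite /quotient_mul -lock; apply/quotient_classP.
have reprE r : congruence_closure (repr (quotient_class r)) r.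
  by apply/quotient_classP/reprK.
exact: cc_trans (cc_mulr _ (reprE s)) (cc_mull _ (reprE t)).
Qed.

Fact quotient_mulA : associative quotient_mul.
Proof.
move=> p q r.
have [s <-] := quotient_class_surj p; have [t <-] := quotient_class_surj q.
have [u <-] := quotient_class_surj r.
by rewrite !quotient_mul_class mulgA.
Qed.

HB.instance Definition _ := isSemigroup.Build quotient_semigroup quotient_mulA.

Lemma quotient_classM s t :
  quotient_class (s * t) = quotient_class s * quotient_class t.
Proof. by rewrite -quotient_mul_class. Qed.

End Congruence.

Definition presented_semigroup (A : choiceType)
    (rels : seq (free_semigroup A * free_semigroup A)) : semigroupType :=
  quotient_semigroup (fun u v => (u, v) \in rels).

Inductive generator := Ga | Gb | Gc | Gd | Ge | Gx.

Definition nat_of_generator g : nat :=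
  (match g with Ga => 0 | Gb => 1 | Gc => 2 | Gd => 3 | Ge => 4 | Gx => 5 end)%N.

Definition generator_of_nat n :=
  nth None [:: Some Ga; Some Gb; Some Gc; Some Gd; Some Ge; Some Gx] n.

Fact nat_of_generatorK : pcancel nat_of_generator generator_of_nat.
Proof. by case. Qed.

HB.instance Definition _ :=
  Countable.copy generator (pcan_type nat_of_generatorK).

Definition T_relations :
    seq (free_semigroup generator * free_semigroup generator) :=
  let a := letter Ga in let b := letter Gb in let c := letter Gc in
  let d := letter Gd in let e := letter Ge in let x := letter Gx in
  [:: (a * x * b, a * c * x);
      (a * c, c * d);
      (x * c * d, x * e);
      (e * d, a * e);
      (a * e * x, a * x);
      (x * e * x * b, b * x * e * x)].

Definition T : semigroupType := presented_semigroup T_relations.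

(* Main.v *)
(** In T no element h satisfies h = uh, h = hv or h = uhv.  Hence, for a finite
    H, an element of H has boundedly many bracketed factorizations all of whose
    subproducts lie in H: the subproducts along a branch form a chain of proper
    divisors in H.  Long words over H are therefore irrelevant, and the words
    of bounded length with a zero, where the zero and every word without such a
    bracketing are sent to one element outside H, wrap H.

    That h = uhv forces u and v to be trivial is seen on four invariants of the
    presentation: the number of [x], the number of [a] and [d] minus the number
    of [b] and [c], a left action depending only on the part before the first
    [x], and a right action depending only on the part after the last [x].
    The two actions leave only powers of [b] for u and v (if h has no [x], the
    right action alone suffices), and the weight excludes these. *)

From HB Require Import structures.
From mathcomp Require Import all_boot.
From mathcomp Require Import boolp classical_sets cardinality.
From mathcomp Require Import zify.
Require Import Defs.

Set Implicit Arguments.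
Unset Strict Implicit.
Unset Printing Implicit Defensive.

Local Open Scope group_scope.

(** * Finite semigroups of bounded words *)

Definition bounded_word (A : finType) (n : nat) := option (n.-bseq A).

HB.instance Definition _ (A : finType) n := Finite.on (bounded_word A n).

Section BoundedWords.
Variables (A : finType) (n : nat).
Implicit Types u v w : bounded_word A n.

Definition bounded_cat u v : bounded_word A n :=
  if u is Some s then if v is Some t then insub (s ++ t : seq A) else None
  else None.

(** If two neighbouring factors are jointly too long, so are all three, and both bracketings give
    [None]. *)
Fact bounded_catA : associative bounded_cat.
Proof.
move=> [u|] [v|] [w|] //=; last by case: insub.
have long (s : seq A) : (n < size s)%N -> insub s = None :> option (n.-bseq A).
  by move=> ns; apply: insubN; rewrite -ltnNge.
case: (insubP (n.-bseq A) (v ++ w : seq A)) => [vw _ vwE|vwN];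
  case: (insubP (n.-bseq A) (u ++ v : seq A)) => [uv _ uvE|uvN] //=.
- by rewrite vwE uvE catA.
- by apply: long; rewrite vwE catA size_cat; lia.
- by apply/esym/long; rewrite uvE -catA size_cat; lia.
Qed.

HB.instance Definition _ :=
  isSemigroup.Build (bounded_word A n) bounded_catA.

End BoundedWords.

Section ProperDivisors.
Variable S : semigroupType.
Implicit Types g h s : S.

Definition properly_divides h s : Prop :=
  [\/ exists u, s = u * h, exists v, s = h * v | exists u v, s = u * h * v].

Lemma properly_divides_mulr h s g :
  properly_divides h s -> properly_divides h (s * g).
Proof.
case=> [[u ->]|[v ->]|[u [v ->]]]; first by apply: Or33; exists u, g.
- by apply: Or32; exists (v * g); rewrite mulgA.
- by apply: Or33; exists u, (v * g); rewrite mulgA.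
Qed.

Lemma properly_divides_mull h s g :
  properly_divides h s -> properly_divides h (g * s).
Proof.
case=> [[u ->]|[v ->]|[u [v ->]]].
- by apply: Or31; exists (g * u); rewrite mulgA.
- by apply: Or33; exists g, v; rewrite mulgA.
- by apply: Or33; exists (g * u), v; rewrite !mulgA.
Qed.

Lemma properly_divides_foldl h s (hs : seq S) :
  h \in hs -> properly_divides h (foldl mul s hs).
Proof.
elim/last_ind: hs => // hs g IHhs; rewrite mem_rcons inE foldl_rcons.
case/orP=> [/eqP ->|/IHhs /properly_divides_mulr //].
by apply: Or31; exists (foldl mul s hs).
Qed.

End ProperDivisors.

(** * Wrapping a finite set when no element properly divides itself *)

Section Wrapping.
Variables (S : semigroupType) (s : S).
Hypothesis irr : forall h : S, ~ properly_divides h h.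
Variable hs : seq S.

(** Every element of [hs] properly divides this product; the seed [s] provides a cofactor even if
    [hs] has one element. *)
Let outside := foldl mul s hs.

Lemma outside_notin : outside \notin hs.
Proof. by apply/negP => /(properly_divides_foldl s) /irr. Qed.

Local Notation A := (seq_sub hs).

Definition word_value (w : seq A) : S :=
  if w is a :: w' then foldl (fun p b => p * val b) (val a) w' else outside.

Lemma word_value_cat u v : u != [::] -> v != [::] ->
  word_value (u ++ v) = word_value u * word_value v.
Proof.
case: u v => [|a u] // [|b v] // _ _ /=; rewrite foldl_cat /=.
elim/last_ind: v => [|v c IHv] //=.
by rewrite !foldl_rcons IHv mulgA.
Qed.

(* Every proper subproduct of the bracketing must have its value in [hs]. *)
Inductive bracketable : seq A -> Prop :=
| bracketable_letter a : bracketable [:: a]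
| bracketable_cat u v : bracketable u -> bracketable v ->
    word_value u \in hs -> word_value v \in hs -> bracketable (u ++ v).

Lemma bracketable_neq0 w : bracketable w -> w != [::].
Proof. by elim=> // -[|a u] v. Qed.

Definition divisor_count g := #|[pred a : A | `[< properly_divides (val a) g >]]|.

Lemma divisor_count_lt g h : g \in hs -> properly_divides g h ->
  (forall k, properly_divides k g -> properly_divides k h) ->
  (divisor_count g < divisor_count h)%N.
Proof.
move=> g_hs gh sub; apply/proper_card/properP; split.
  by apply/fintype.subsetP => a /asboolP /sub ?; apply/asboolP.
exists (SeqSub g_hs); first exact/asboolP.
by apply/negP => /asboolP /irr.
Qed.

(** Each split lowers the divisor count, which thus bounds the depth of the binary bracketing tree;
    its leaves are the letters. *)
Lemma size_bracketable w : bracketable w ->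
  (size w <= 2 ^ divisor_count (word_value w))%N.
Proof.
elim=> [a|u v bu IHu bv IHv u_hs v_hs]; first by rewrite expn_gt0.
rewrite size_cat word_value_cat ?bracketable_neq0 //.
set g := word_value u in u_hs IHu *; set h := word_value v in v_hs IHv *.
have ltg : (divisor_count g < divisor_count (g * h))%N.
  apply: divisor_count_lt => // [|k]; first by apply: Or32; exists h.
  exact: properly_divides_mulr.
have lth : (divisor_count h < divisor_count (g * h))%N.
  apply: divisor_count_lt => // [|k]; first by apply: Or31; exists g.
  exact: properly_divides_mull.
case: (divisor_count (g * h)) ltg lth => // m ltg lth.
rewrite expnS mul2n -addnn leq_add //.
  by apply: leq_trans IHu _; rewrite leq_exp2l.
by apply: leq_trans IHv _; rewrite leq_exp2l.
Qed.

Let D := bounded_word A (2 ^ #|{: A}|).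

Definition wrap (w : D) : S :=
  if w is Some t then if `[< bracketable t >] then word_value t else outside
  else outside.

Lemma wrapP (w : D) : wrap w \in hs ->
  exists t, [/\ w = Some t, bracketable t & wrap w = word_value t].
Proof.
case: w => [t|] /=; last by rewrite (negPf outside_notin).
case: asboolP => [bt _|_]; last by rewrite (negPf outside_notin).
by exists t.
Qed.

Lemma insub_bracketable (w : seq A) : bracketable w ->
  exists2 t : (2 ^ #|{: A}|).-bseq A, val t = w & insub w = Some t.
Proof.
move=> bw; case: insubP => [t _ tw|]; first by exists t.
case/negP; apply: leq_trans (size_bracketable bw) _.
by rewrite leq_exp2l // max_card.
Qed.

Lemma wrap_insub (w : seq A) : bracketable w ->
  wrap (insub w) = word_value w.
Proof.
by move=> bw; have [t tw ->] /= := insub_bracketable bw; rewrite tw asboolT.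
Qed.

Lemma wrapM (x y : D) : wrap x \in hs -> wrap y \in hs ->
  wrap (x * y) = wrap x * wrap y.
Proof.
move=> xh yh; have [t [xE bt tE]] := wrapP xh; have [r [yE br rE]] := wrapP yh.
rewrite tE rE -word_value_cat ?bracketable_neq0 // xE yE.
(* Both values lie in [hs], so the concatenation is bracketable, hence short enough not to become
   the zero. *)
by apply: wrap_insub; apply: bracketable_cat; rewrite -?tE -?rE.
Qed.

End Wrapping.

Lemma irreflexive_division_LWF (S : semigroupType) (s : S) :
  (forall h : S, ~ properly_divides h h) -> LWF S.
Proof.
move=> irr H /finite_seqP[hs ->]; exists _, (@wrap S s hs); split=> [h /= h_hs|].
  exists (insub [:: SeqSub h_hs]) => //.
  by rewrite (wrap_insub irr) //; apply: bracketable_letter.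
by move=> x y; apply: wrapM.
Qed.

(** * Four invariants of the presentation *)

(* Erase [b] and identify [c] with [e]: the part p before the first [x] is then
   subject to ed = ae and to aex = ax only.  The state 2k codes p = d^k; the odd
   states code the other p, coarsely by length. *)
Definition prefix_act (g : generator) (q : nat) : nat :=
  match g with
  | Ga => if odd q then q.+2 else q.+3
  | Gb => q
  | Gc | Ge => if odd q then q.+2 else q.+1
  | Gd => q.+2
  | Gx => 0
  end.

(** Letter weights summed since the last [Gx]: axb = acx forces b to weigh 0, and xcd = xe makes e
    weigh as much as c and d together. *)
Definition suffix_act (q : nat) (g : generator) : nat :=
  match g with
  | Ga | Gc | Gd => q.+1
  | Gb => q
  | Ge => q.+2
  | Gx => 0
  end.

Definition is_ad g := (g == Ga) || (g == Gd).
Definition is_bc g := (g == Gb) || (g == Gc).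

Definition same_invariants (u v : seq generator) : Prop :=
  [/\ forall q, foldr prefix_act q u = foldr prefix_act q v,
      forall q, foldl suffix_act q u = foldl suffix_act q v,
      count_mem Gx u = count_mem Gx v
    & (count is_ad u + count is_bc v = count is_ad v + count is_bc u)%N].

Lemma T_relations_same_invariants r : r \in T_relations ->
  same_invariants (word r.1) (word r.2).
Proof.
have parity q : odd q.+1 = ~~ odd q by [].
rewrite /T_relations !inE.
by do 5?[case/orP]; move/eqP->; split=> //= q; rewrite ?parity;
   case: (boolP (odd q)) => //= oq; rewrite ?oq ?(negPf oq).
Qed.

Lemma congruence_same_invariants u v :
  congruence_closure (fun u v => (u, v) \in T_relations) u v ->
  same_invariants (word u) (word v).
Proof.
elim=> {u v} [u v /T_relations_same_invariants //|//|u v _ []|||].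
- by move=> pE sE xE wE; split=> //; lia.
- move=> u v w _ [p1 s1 x1 w1] _ [p2 s2 x2 w2].
  by split=> [q|q||]; rewrite ?p1 ?s1 ?x1 //; lia.
- move=> w u v _ [pE sE xE wE]; rewrite !word_mul.
  by split=> [q|q||]; rewrite ?foldr_cat ?foldl_cat ?count_cat ?pE ?sE; lia.
- move=> w u v _ [pE sE xE wE]; rewrite !word_mul.
  by split=> [q|q||]; rewrite ?foldr_cat ?foldl_cat ?count_cat ?pE ?sE; lia.
Qed.

(** * Excluding self-divisors by the invariants *)

Lemma prefix_act_reset w q q' : Gx \in w ->
  foldr prefix_act q w = foldr prefix_act q' w.
Proof. by elim: w => // -[] w IHw //=; rewrite ?inE // => /IHw ->. Qed.

(** Every letter other than [Gb] and [Gx] raises the state, whatever its parity. *)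
Lemma prefix_act_leif w q : Gx \notin w ->
  (q <= foldr prefix_act q w ?= iff all (pred1 Gb) w)%N.
Proof.
elim: w => [|g w IHw]; first by move=> _; split; rewrite ?eqxx.
rewrite inE negb_or => /andP[gx /IHw [le_q eq_q]].
set p := foldr prefix_act q w in le_q eq_q *.
have -> : foldr prefix_act q (g :: w) = prefix_act g p by [].
by case: g gx => //= _; split; rewrite ?eq_q //; case: (odd p); lia.
Qed.

Lemma suffix_act_reset w q q' : Gx \in w ->
  foldl suffix_act q w = foldl suffix_act q' w.
Proof.
elim/last_ind: w => // w g IHw; rewrite mem_rcons inE !foldl_rcons.
by case: g => //= /IHw ->.
Qed.

Lemma suffix_actD w q : Gx \notin w ->
  foldl suffix_act q w = (q + foldl suffix_act 0 w)%N.
Proof.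
elim/last_ind: w => [|w g IHw]; first by rewrite addn0.
rewrite mem_rcons inE negb_or !foldl_rcons => /andP[gx /IHw ->].
by case: g gx => //= _; lia.
Qed.

Lemma suffix_act_eq0 w : Gx \notin w ->
  (foldl suffix_act 0 w == 0)%N = all (pred1 Gb) w.
Proof.
elim/last_ind: w => // w g IHw.
rewrite mem_rcons inE negb_or all_rcons foldl_rcons => /andP[gx /IHw eq0].
by case: g gx => //= _; rewrite eq0.
Qed.

Lemma same_invariants_factor u h v :
  same_invariants h (u ++ h ++ v) -> u ++ v = [::].
Proof.
case=> pE sE xE wE.
have [ux vx] : Gx \notin u /\ Gx \notin v.
  by rewrite -!has_pred1 !has_count; move: xE; rewrite !count_cat; lia.
have [/all_pred1P uE /all_pred1P vE] : all (pred1 Gb) u /\ all (pred1 Gb) v.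
  move: (sE 0%N); rewrite !foldl_cat (suffix_actD _ vx).
  have [hx|hx] := boolP (Gx \in h).
    (* An x in [h] hides [u] from the right action and [v] from the left one, so each action tests
       one factor. *)
    rewrite (suffix_act_reset (foldl _ _ u) 0 hx) => sv.
    split; last by rewrite -suffix_act_eq0 //; lia.
    move: (pE 0%N); rewrite !foldr_cat.
    rewrite (prefix_act_reset (foldr _ _ v) 0 hx) => pu.
    by rewrite -(prefix_act_leif (foldr prefix_act 0 h) ux).2 -pu.
  (* With no x anywhere, the suffix weights of [u] and [v] must sum to 0. *)
  by rewrite (suffix_actD (foldl _ _ u) hx) -!suffix_act_eq0 //; lia.
(* Each b contributes -1 to the last invariant, so none is left. *)
move: wE; rewrite uE vE !count_cat !count_nseq /= => wE.
by have [-> ->] : size u = 0%N /\ size v = 0%N by lia.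
Qed.

Lemma T_irreflexive_division (h : T) : ~ properly_divides h h.
Proof.
have word0 (u : free_semigroup generator) : word u <> [::].
  by case: u => -[].
have [w <-] := quotient_class_surj h.
case=> [[p]|[p]|[p [q]]]; have [u <-] := quotient_class_surj p.
- rewrite -quotient_classM => /quotient_classP/congruence_same_invariants.
  have := @same_invariants_factor (word u) (word w) [::].
  by rewrite !cats0 => uw1 /uw1 /word0.
- rewrite -quotient_classM => /quotient_classP/congruence_same_invariants.
  by move/(@same_invariants_factor [::]) => /word0.
- have [v <-] := quotient_class_surj q.
  rewrite -!quotient_classM => /quotient_classP/congruence_same_invariants.
  rewrite !word_mul -catA => /same_invariants_factor.
  by case: (word u) (word0 u).
Qed.

Theorem proposition14 : LWF T.
Proof.
exact: irreflexive_division_LWF (quotient_class _ (letter Ga))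
  T_irreflexive_division.
Qed.
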